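(* In dimension $n=4$ the biharmonic potential of the Gaussian has the representation $$\mathcal B_4(e^{-|\cdot|^2})(\mathbf x)=\frac1{16}\left(\frac{e^{-|\mathbf x|^2}-1}{|\mathbf x|^2}-2\log|\mathbf x|-E_1(|\mathbf x|^2)\right),\qquad \mathbf x\in\mathbb R^4\setminus\{0\},$$ where $E_1(r)=\int_r^\infty\frac{e^{-t}}{t}\,dt$ is the exponential integral.
   Context: In dimension $4$ the biharmonic potential (convolution with the fundamental solution of $\Delta\Delta$) is $$\mathcal B_4 f(\mathbf x)=-\frac{1}{8\pi^2}\int_{\mathbb R^4}\ln|\mathbf x-\mathbf y|\,f(\mathbf y)\,d\mathbf y .$$ *)

(* Defs.v *)
From HB Require Import structures.
From mathcomp Require Import all_boot all_order all_algebra.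
From mathcomp Require Import all_classical all_reals all_analysis.

Set Implicit Arguments.
Unset Strict Implicit.
Unset Printing Implicit Defensive.

Import Order.TTheory GRing.Theory Num.Theory.
Import numFieldNormedType.Exports.

Local Open Scope classical_set_scope.
Local Open Scope ring_scope.

(* R^4 is the iterated binary product, so that the library's product
   sigma-algebra, product measure and Fubini theorems apply to it. *)
Notation R4 R := (measurableTypeR R * measurableTypeR R
                  * measurableTypeR R * measurableTypeR R)%type.

Definition lebesgue4 (R : realType) : set (R4 R) -> \bar R :=
  (@lebesgue_measure R \x @lebesgue_measure R
   \x @lebesgue_measure R \x @lebesgue_measure R)%E.

(* The library's norm `|x| on a product is the sup norm, hence this one. *)
Definition eucl4 (R : realType) (x : R4 R) : R :=
  Num.sqrt (x.1.1.1 ^+ 2 + x.1.1.2 ^+ 2 + x.1.2 ^+ 2 + x.2 ^+ 2).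

(* The integral is the extended-real one: it is a finite number only if the
   integrand is integrable.  At y = x the integrand takes the value
   ln 0 * f x = 0, which is irrelevant, a point being negligible. *)
Definition biharmonic4 (R : realType) (f : R4 R -> R) (x : R4 R) : \bar R :=
  ((- (8 * pi ^+ 2)^-1)%:E *
   \int[@lebesgue4 R]_(y in [set: R4 R]) (ln (eucl4 (x - y)) * f y)%:E)%E.

Definition E1 (R : realType) (r : R) : R :=
  \int[@lebesgue_measure R]_(t in `[r, +oo[) (expR (- t) / t).

(* Main.v *)
Require Import Defs.
From HB Require Import structures.
From mathcomp Require Import all_boot all_order all_algebra.
From mathcomp Require Import ring lra.
From mathcomp Require Import all_classical all_reals all_analysis measurable_realfun.
Import Order.TTheory GRing.Theory Num.Theory.
Import numFieldNormedType.Exports.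
Local Open Scope classical_set_scope.
Local Open Scope ring_scope.

(** Write s = |x - y|^2, r = |x|^2 and u = e / (1 + e).  Since E1 + ln is
    1-Lipschitz on the positive axis, E1(e) - E1(e s) differs from ln s by at
    most e (1 + s), which is integrable against the Gaussian.  As
    E1(e s) is the integral of exp(-t s) / t over t >= e, Tonelli's theorem
    reduces its Gaussian integral over R^4 to that of
    (pi / (1 + t))^2 exp(-r t / (1 + t)) / t, which has the explicit primitive
    pi^2 (exp(-r t / (1 + t)) / r - E1(r t / (1 + t))).  Hence the Gaussian
    integral of ln s is within O(e) of
    pi^2 (E1(e) - E1(r u) + E1(r) + (exp(-r u) - exp(-r)) / r), which is
    itself within O(e) of pi^2 (ln r + E1(r) + (1 - exp(-r)) / r); let e tend
    to 0. *)

Set Implicit Arguments.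
Unset Strict Implicit.
Unset Printing Implicit Defensive.

(** * Improper integrals on half-lines and the exponential integral *)

(** Fundamental theorem on a half-line, for primitives differentiable at the endpoint too: this
    gives the right-continuity of [F] at [a]. All explicit integrals in [t] below are computed with
    it. *)
Lemma ge0_integral_is_derive_y {R : realType} (f F : R -> R) (a l : R) :
  (forall x, a <= x -> 0 <= f x) ->
  (forall x, a <= x -> {for x, continuous f}) ->
  (forall x, a <= x -> is_derive x 1 F (f x)) ->
  F x @[x --> +oo] --> l ->
  (\int[@lebesgue_measure R]_(x in `[a, +oo[) (f x)%:E = (l - F a)%:E)%E.
Proof.
move=> f0 cf dF Fl; rewrite EFinB.
apply: ge0_continuous_FTC2y => //.
- apply: continuous_in_subspaceT => x; rewrite inE/= in_itv/= andbT.
  exact: cf.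
- by move=> x /ltW /dF [].
- apply: cvg_at_right_filter.
  have [dFa _] := dF _ (lexx a).
  by apply: differentiable_continuous; exact/derivable1_diffP.
- move=> x; rewrite in_itv/= andbT => /ltW /dF dFx.
  by rewrite derive1E derive_val.
Qed.

Lemma continuous_measurable_itvcy {R : realType} (f : R -> R) (a : R) :
  (forall x, a <= x -> {for x, continuous f}) ->
  measurable_fun (`[a, +oo[ : set (measurableTypeR R)) f.
Proof.
move=> cf; apply: subspace_continuous_measurable_fun => //.
by apply: continuous_in_subspaceT => x; rewrite inE/= in_itv/= andbT; exact: cf.
Qed.

Lemma integral_expRN {R : realType} (a : R) :
  (\int[@lebesgue_measure R]_(x in `[a, +oo[) (expR (- x))%:E = (expR (- a))%:E)%E.
Proof.
have dF (x : R) : a <= x -> is_derive x 1 (fun x : R => - expR (- x)) (expR (- x)).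
  by move=> _; apply: is_derive_eq; rewrite mulrN1 opprK.
have Fl : - expR (- x) @[x --> +oo] --> (0 : R).
  by rewrite -oppr0; apply: cvgN; exact: cvgr_expR.
rewrite (ge0_integral_is_derive_y _ _ dF Fl) ?opprK ?add0r//.
by move=> x _; apply: continuous_comp; [exact: opp_continuous|exact: continuous_expR].
Qed.

Lemma expint_continuous {R : realType} (x : R) : 0 < x ->
  {for x, continuous (fun t : R => expR (- t) / t)}.
Proof.
move=> x0; apply: cvgM.
  apply: continuous_comp; first exact: opp_continuous.
  exact: continuous_expR.
by apply: cvgV; [rewrite gt_eqF|exact: cvg_id].
Qed.

(** On this half-line [t^-1] is at most [a^-1], so a multiple of [expR (- t)] dominates. *)
Lemma expint_integrable {R : realType} (a : R) : 0 < a ->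
  (@lebesgue_measure R).-integrable `[a, +oo[ (fun t => (expR (- t) / t)%:E).
Proof.
move=> a0.
have iexp : (@lebesgue_measure R).-integrable `[a, +oo[
    (fun t => (a^-1)%:E * (expR (- t))%:E)%E.
  apply: integrableZl => //; apply/integrableP; split.
    by apply/measurable_EFinP; apply: measurableT_comp.
  under eq_integral do rewrite /= ger0_norm ?expR_ge0//.
  by rewrite integral_expRN ltry.
apply: le_integrable iexp => //.
- apply/measurable_EFinP; apply: continuous_measurable_itvcy => x ax.
  by apply: expint_continuous; exact: lt_le_trans ax.
- move=> t; rewrite /= in_itv/= andbT => at_.
  have t0 : 0 < t by exact: lt_le_trans at_.
  rewrite lee_fin !ger0_norm ?mulr_ge0 ?divr_ge0 ?invr_ge0 ?expR_ge0 ?(ltW a0) ?(ltW t0)//.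
  by rewrite mulrC ler_pM2r ?expR_gt0// lef_pV2.
Qed.

Lemma integral_E1 {R : realType} (a : R) : 0 < a ->
  (\int[@lebesgue_measure R]_(t in `[a, +oo[) (expR (- t) / t)%:E = (E1 a)%:E)%E.
Proof.
move=> a0; rewrite /E1 /Rintegral fineK//.
by apply: integrable_fin_num => //; exact: expint_integrable.
Qed.

Lemma E1_ge0 {R : realType} (a : R) : 0 < a -> 0 <= E1 a.
Proof.
move=> a0; apply: Rintegral_ge0 => t; rewrite /= in_itv/= andbT => at_.
by rewrite divr_ge0 ?expR_ge0// (le_trans (ltW a0)).
Qed.

(** The factor [t^-1] is at most 1 on the domain. Only the resulting decay at infinity matters
    later. *)
Lemma E1_le {R : realType} (a : R) : 1 <= a -> E1 a <= expR (- a).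
Proof.
move=> a1; have a0 : 0 < a by exact: lt_le_trans a1.
rewrite -lee_fin -integral_E1// -integral_expRN; apply: ge0_le_integral => //.
- move=> t; rewrite /= in_itv/= andbT => at_.
  by rewrite lee_fin divr_ge0 ?expR_ge0// (le_trans (ltW a0)).
- by have /integrableP[] := expint_integrable a0.
- by apply/measurable_EFinP; apply: measurableT_comp.
- move=> t; rewrite /= in_itv/= andbT => at_.
  rewrite lee_fin ler_pdivrMr ?(lt_le_trans a0)// ler_peMr ?expR_ge0//.
  exact: le_trans at_.
Qed.

Lemma cvg_E1_y {R : realType} : E1 x @[x --> (+oo : set_system R)] --> (0 : R).
Proof.
apply: (squeeze_cvgr _ (cvg_cst 0) (@cvgr_expR R)).
near=> x; have x1 : 1 <= x by near: x; exact: nbhs_pinfty_ge.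
by rewrite E1_ge0 ?E1_le// (lt_le_trans ltr01).
Unshelve. all: by end_near. Qed.

(** The fundamental theorem concerns a variable upper endpoint, so near [x] the function is
    rewritten as [E1 (x / 2)] minus the integral from [x / 2] to [y]; the base point [x / 2] keeps
    the domain away from the pole at 0. *)
Lemma is_derive_E1 {R : realType} (x : R) : 0 < x ->
  is_derive x 1 (@E1 R) (- (expR (- x) / x)).
Proof.
move=> x0; set f := fun t : R => expR (- t) / t.
have x20 : 0 < x / 2 by rewrite divr_gt0.
have x2x : x / 2 < x by rewrite ltr_pdivrMr// ltr_pMr// ltr1n.
have intf := expint_integrable x20.
have [] := @continuous_FTC1 R f (BLeft (x / 2)) x (x + 1).
- by rewrite ltrDl.
- apply: integrableS intf => //.
  by apply: subset_itvl.
- by rewrite lte_fin.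
- exact: expint_continuous.
rewrite derive1E => dF Fx.
apply: (@near_eq_is_derive _ _ _ (fun y => E1 (x / 2) -
    \int[@lebesgue_measure R]_(t in `[x / 2, y]) f t)).
- near=> y.
  have y2 : x / 2 < y by near: y; exact: lt_nbhsr.
  rewrite (@Rintegral_itvB _ f (BLeft (x / 2)) +oo%O y)//.
  + rewrite Rintegral_itv_obnd_cbnd//.
    apply: integrableS intf => //; apply: subset_itv => //.
    by rewrite bnd_simp ltW.
  + by rewrite bnd_simp ltW.
- have := DeriveDef dF Fx => dF'.
  by apply: is_derive_eq; rewrite add0r mul1r.
Unshelve. all: by end_near. Qed.

(** * Approximating the logarithm by differences of [E1] *)

Lemma is_derive_continuous {R : realType} (f : R -> R) (x df : R) :
  is_derive x 1 f df -> {for x, continuous f}.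
Proof. by case=> /derivable1_diffP /differentiable_continuous. Qed.

(** The singularities at 0 cancel: the derivative of the sum is [(1 - expR (- x)) / x], which lies
    between 0 and 1 because [expR (- x)] is at least [1 - x]. The mean value theorem concludes. *)
Lemma E1_ln_lipschitz {R : realType} (a b : R) : 0 < a -> 0 < b ->
  `|(E1 a + ln a) - (E1 b + ln b)| <= `|a - b|.
Proof.
wlog ab : a b / a <= b => [wlg a0 b0|a0 _].
  have [/wlg/(_ a0 b0)//|/ltW/wlg/(_ b0 a0)] := leP a b.
  by rewrite distrC (distrC b).
have dE (x : R) : 0 < x ->
    is_derive x 1 (fun t => E1 t + ln t) ((1 - expR (- x)) / x).
  move=> x0; have d1 := is_derive_E1 x0; have d2 := is_derive1_ln x0.
  by apply: is_derive_eq; rewrite mulrBl mul1r addrC.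
have [x||c] := @MVT_segment R (fun t => E1 t + ln t)
  (fun x => (1 - expR (- x)) / x) a b ab.
- by rewrite in_itv/= => /andP[/(lt_trans a0) x0 _]; exact: dE.
- apply: continuous_in_subspaceT => x; rewrite inE/= in_itv/= => /andP[ax _].
  exact: is_derive_continuous (dE _ (lt_le_trans a0 ax)).
rewrite in_itv/= => /andP[ac cb] H.
have c0 : 0 < c by exact: lt_le_trans ac.
rewrite distrC H normrM (distrC a) ler_piMl// ger0_norm.
  rewrite ler_pdivrMr// mul1r lerBlDr -lerBlDl.
  have := expR_ge1Dx (- c); lra.
by rewrite divr_ge0 ?subr_ge0 ?expR_le1 ?oppr_le0 ?ltW.
Qed.

(** Apply the Lipschitz bound at [e] and [e * s]: the two copies of [ln e] cancel and leave
    [ln s]. *)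
Lemma ln_E1_approx {R : realType} (e s : R) : 0 < e -> 0 < s ->
  `|ln s - (E1 e - E1 (e * s))| <= e * (1 + s).
Proof.
move=> e0 s0; have es0 : 0 < e * s by rewrite mulr_gt0.
have := E1_ln_lipschitz e0 es0; rewrite distrC lnM ?posrE//.
have -> : E1 (e * s) + (ln e + ln s) - (E1 e + ln e) =
  ln s - (E1 e - E1 (e * s)) by ring.
move=> /le_trans; apply; rewrite -{1}(mulr1 e) -mulrBr normrM gtr0_norm//.
by rewrite ler_pM2l// (le_trans (ler_normB _ _))// normr1 gtr0_norm.
Qed.

(** * Explicit integrals over [t >= e] *)

Lemma expint_scale_continuous {R : realType} (s t : R) : 0 < t ->
  {for t, continuous (fun t : R => expR (- (t * s)) / t)}.
Proof.
move=> t0; apply: cvgM; last by apply: cvgV; [rewrite gt_eqF|exact: cvg_id].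
apply: continuous_comp; last exact: continuous_expR.
by apply: cvgN; apply: cvgM; [exact: cvg_id|exact: cvg_cst].
Qed.

(** Instead of a change of variables, the primitive [- E1 (t * s)] is used; it vanishes at
    infinity. *)
Lemma integral_E1_scale {R : realType} (e s : R) : 0 < e -> 0 < s ->
  (\int[@lebesgue_measure R]_(t in `[e, +oo[) (expR (- (t * s)) / t)%:E =
   (E1 (e * s))%:E)%E.
Proof.
move=> e0 s0.
have dF (t : R) : e <= t ->
    is_derive t 1 (fun t : R => - E1 (t * s)) (expR (- (t * s)) / t).
  move=> et; have t0 : 0 < t by exact: lt_le_trans et.
  have d1 := is_derive_E1 (mulr_gt0 t0 s0).
  have d2 : is_derive t 1 (fun t : R => t * s) s.
    by apply: is_derive_eq; rewrite scaler0 add0r; exact: mulr1.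
  have d3 := @is_derive1_comp _ (@E1 R) (fun t => t * s) _ _ _ d1 d2.
  apply: is_derive_eq.
  by field; rewrite !gt_eqF.
have Fl : - E1 (x * s) @[x --> +oo] --> (0 : R).
  rewrite -oppr0; apply: cvgN; apply: cvg_comp cvg_E1_y.
  by apply: gt0_cvgMly => //; exact: cvg_id.
rewrite (ge0_integral_is_derive_y _ _ dF Fl) ?opprK ?add0r//.
- by move=> x ex; rewrite divr_ge0 ?expR_ge0// (le_trans (ltW e0)).
- by move=> x ex; apply: expint_scale_continuous; exact: lt_le_trans ex.
Qed.

Lemma gauss_kernel_continuous {R : realType} (r t : R) : 0 < t ->
  {for t, continuous
    (fun t : R => expR (- (r * (t / (1 + t)))) / ((1 + t) ^+ 2 * t))}.
Proof.
move=> t0; have t1 : 0 < 1 + t by rewrite addr_gt0.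
have c1 : {for t, continuous (fun t : R => 1 + t)}.
  by apply: cvgD; [exact: cvg_cst|exact: cvg_id].
apply: cvgM.
  apply: (cvg_comp (fun t => - (r * (t / (1 + t)))) expR); last exact: continuous_expR.
  apply: cvgN; apply: cvgM; first exact: cvg_cst.
  by apply: cvgM; [exact: cvg_id|apply: cvgV => //; rewrite gt_eqF].
apply: cvgV; first by rewrite gt_eqF// mulr_gt0// exprn_gt0.
by apply: cvgM; [exact: cvgM|exact: cvg_id].
Qed.

Lemma integral_gauss_kernel {R : realType} (e r : R) : 0 < e -> 0 < r ->
  (\int[@lebesgue_measure R]_(t in `[e, +oo[)
     (expR (- (r * (t / (1 + t)))) / ((1 + t) ^+ 2 * t))%:E =
   (E1 (r * (e / (1 + e))) - E1 r
    + (expR (- r) - expR (- (r * (e / (1 + e))))) / r)%:E)%E.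
Proof.
(* Since [u' = r / (1 + t)^2] and [1/u - 1/r = 1/(r t)], the derivative
   [expR (- u) * u' * (1/u - 1/r)] of [F] is the integrand. As [u] tends to [r] at infinity, the
   limit of [F] comes from continuity at [r > 0]. *)
move=> e0 r0; pose u (t : R) := r * (t / (1 + t)).
pose F (t : R) := - E1 (u t) + expR (- u t) / r.
have u0 (t : R) : 0 < t -> 0 < u t.
  by move=> t0; rewrite mulr_gt0// divr_gt0// addr_gt0.
have du (t : R) : 0 < t -> is_derive t 1 u (r / (1 + t) ^+ 2).
  move=> t0; have t1 : 1 + t != 0 by rewrite gt_eqF// addr_gt0.
  have d1 : is_derive t 1 (fun t : R => 1 + t) 1.
    by apply: is_derive_eq; rewrite add0r mulr1.
  have d2 := @is_deriveV _ (fun t => 1 + t) _ _ _ t1 d1.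
  rewrite /u; apply: is_derive_eq.
  rewrite /GRing.scale /=; field; exact: t1.
have dF (t : R) : e <= t ->
    is_derive t 1 F (expR (- u t) / ((1 + t) ^+ 2 * t)).
  move=> et; have t0 : 0 < t by exact: lt_le_trans et.
  have t1 : 1 + t != 0 by rewrite gt_eqF// addr_gt0.
  have d3 := @is_derive1_comp _ (@E1 R) u _ _ _ (is_derive_E1 (u0 _ t0)) (du _ t0).
  have d0 := du _ t0.
  rewrite /F; apply: is_derive_eq; rewrite /u /GRing.scale /=.
  by field; rewrite !gt_eqF ?addr_gt0.
have ul : u t @[t --> +oo] --> (r : R).
  have -> : r = r * (1 - 0) by ring.
  apply: (@cvg_trans _ ((r * (1 - (1 + t)^-1)) @[t --> +oo])).
    apply: near_eq_cvg; near=> t; rewrite /u; field.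
    by rewrite gt_eqF// addr_gt0//; near: t; exact: nbhs_pinfty_gt.
  apply: cvgM; first exact: cvg_cst.
  apply: cvgB; first exact: cvg_cst.
  have pos : \forall t \near +oo, 0 < 1 + t :> R.
    by near=> t; rewrite addr_gt0//; near: t; exact: nbhs_pinfty_gt.
  apply/(gtr0_cvgV0 pos)/cvgryPge => A; near=> t.
  have : A <= t by near: t; apply: nbhs_pinfty_ge; rewrite num_real.
  lra.
have Fl : F t @[t --> +oo] --> - E1 r + expR (- r) / r.
  apply: cvgD.
    apply: cvgN; apply: (cvg_comp u (@E1 R) ul).
    exact: is_derive_continuous (is_derive_E1 r0).
  apply: cvgM; last exact: cvg_cst.
  apply: (cvg_comp (fun t => - u t) expR (cvgN ul)).
  exact: continuous_expR.
rewrite (ge0_integral_is_derive_y _ _ dF Fl) /F -/(u e).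
- by congr EFin; ring.
- move=> t et; have t0 : 0 < t by exact: lt_le_trans et.
  by rewrite divr_ge0 ?expR_ge0// mulr_ge0 ?sqr_ge0 ?ltW.
- by move=> t et; apply: gauss_kernel_continuous; exact: lt_le_trans et.
Unshelve. all: by end_near. Qed.

(** * Gaussian integrals on the line and on R^4 *)

(** Besides positive [t], the later proofs use [t = 0] (the Gaussian itself) and [t = -1/2] (a
    majorant for quadratic growth), hence the range. *)
Lemma integral_gauss_shift {R : realType} (t x : R) : -1 < t ->
  (\int[@lebesgue_measure R]_y (expR (- (t * (x - y) ^+ 2)) * expR (- y ^+ 2))%:E =
   (Num.sqrt (pi / (1 + t)) * expR (- (x ^+ 2 * (t / (1 + t)))))%:E)%E.
Proof.
move=> t1; have t0 : 0 < 1 + t by lra.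
(* Completing the square in [y] gives a multiple of the normal density with mean [m] and variance
   [(2 * (1 + t))^-1]. *)
pose m := t * x / (1 + t); pose sg : R := Num.sqrt ((2 * (1 + t))^-1).
have sg2 : sg ^+ 2 = (2 * (1 + t))^-1.
  by rewrite sqr_sqrtr// invr_ge0 mulr_ge0// ltW.
have sg0 : sg != 0 by rewrite gt_eqF// sqrtr_gt0 invr_gt0 mulr_gt0.
set C := (X in _ = X%:E).
have E y : expR (- (t * (x - y) ^+ 2)) * expR (- y ^+ 2) = C * normal_pdf m sg y.
  rewrite normal_pdfE// /normal_peak /normal_fun sg2 /C.
  have -> : (2 * (1 + t))^-1 * pi *+ 2 = pi / (1 + t).
    by rewrite -mulr_natr; field; rewrite gt_eqF.
  have sp : Num.sqrt (pi / (1 + t)) != 0 :> R.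
    by rewrite gt_eqF// sqrtr_gt0 divr_gt0// pi_gt0.
  rewrite mulrACA mulfV// mul1r -!expRD; congr expR.
  by rewrite /m -mulr_natr; field; rewrite gt_eqF.
under eq_integral do rewrite E EFinM.
rewrite ge0_integralZl_EFin//.
- by rewrite integral_normal_pdf mule1.
- by move=> y _; rewrite lee_fin normal_pdf_ge0.
- by apply/measurable_EFinP; exact: measurable_normal_pdf.
- by rewrite mulr_ge0 ?expR_ge0.
Qed.

(* The library's sigma-finite instance on [\x] for general factors is shadowed by
   the one for subprobabilities, so it is redeclared on a new constant. *)
Section sigma_finite_product.
Context {d1 d2 : measure_display} {T1 : measurableType d1} {T2 : measurableType d2}
  {R : realType}.
Variables (m1 : {sigma_finite_measure set T1 -> \bar R})
  (m2 : {sigma_finite_measure set T2 -> \bar R}).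

Definition sfprod : set (T1 * T2) -> \bar R := (m1 \x m2)%E.

HB.instance Definition _ := Measure.on sfprod.

(** Rectangles of two increasing exhaustions cover: by monotonicity a pair lies in the one indexed
    by the larger of its two indices. *)
Lemma sfprod_sigma_finite : sigma_finite setT sfprod.
Proof.
have /sigma_finiteP[F [FT Fnd Ffin]] := sigma_finiteT m1.
have /sigma_finiteP[G [GT Gnd Gfin]] := sigma_finiteT m2.
exists (fun n => F n `*` G n) => [|n].
  apply/esym/seteqP; split=> // -[y z] _.
  have [i _ Fy] : (\bigcup_n F n) y by rewrite -FT.
  have [j _ Gz] : (\bigcup_n G n) z by rewrite -GT.
  exists (maxn i j) => //; split=> /=.
    by have /subsetPset := Fnd _ _ (leq_maxl i j); apply.
  by have /subsetPset := Gnd _ _ (leq_maxr i j); apply.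
have [mF Fn] := Ffin n; have [mG Gn] := Gfin n; split; first exact: measurableX.
by rewrite [sfprod _]product_measure1E// lte_mul_pinfty// ge0_fin_numE.
Qed.

HB.instance Definition _ := Measure_isSigmaFinite.Build _ _ _ sfprod sfprod_sigma_finite.

End sigma_finite_product.
Local Notation leb R := (@lebesgue_measure R).
Local Notation leb4 R := (sfprod (sfprod (sfprod (leb R) (leb R)) (leb R)) (leb R)).

Lemma integral_prodM {d1 d2 : measure_display} {T1 : measurableType d1}
    {T2 : measurableType d2} {R : realType}
    (m1 : {sigma_finite_measure set T1 -> \bar R})
    (m2 : {sigma_finite_measure set T2 -> \bar R})
    (f : T1 -> R) (g : T2 -> R) (a b : R) :
  measurable_fun setT f -> measurable_fun setT g ->
  (forall x, 0 <= f x) -> (forall x, 0 <= g x) ->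
  (\int[m1]_x (f x)%:E = a%:E)%E -> (\int[m2]_x (g x)%:E = b%:E)%E ->
  (\int[sfprod m1 m2]_z (f z.1 * g z.2)%:E = (a * b)%:E)%E.
Proof.
move=> mf mg f0 g0 fa gb.
have b0 : (0 <= b%:E)%E by rewrite -gb integral_ge0// => x _; rewrite lee_fin.
rewrite fubini_tonelli1//.
- rewrite /fubini_F /=; under eq_integral.
    move=> x _; under eq_integral do rewrite EFinM.
    rewrite ge0_integralZl_EFin//; last 2 first.
    - by move=> y _; rewrite lee_fin.
    - exact/measurable_EFinP.
    rewrite gb; over.
  rewrite ge0_integralZr//; first by rewrite fa EFinM.
  - exact/measurable_EFinP.
  - by move=> x _; rewrite lee_fin.
- apply/measurable_EFinP; apply: measurable_funM; exact: measurableT_comp.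
- by move=> z; rewrite lee_fin mulr_ge0.
Qed.

Lemma eucl4_sqr {R : realType} (x : R4 R) :
  eucl4 x ^+ 2 = x.1.1.1 ^+ 2 + x.1.1.2 ^+ 2 + x.1.2 ^+ 2 + x.2 ^+ 2.
Proof. by rewrite sqr_sqrtr// !addr_ge0 ?sqr_ge0. Qed.

Lemma integral_gauss4 {R : realType} (t : R) (x : R4 R) : -1 < t ->
  (\int[leb4 R]_y
     (expR (- (t * eucl4 (x - y) ^+ 2)) * expR (- eucl4 y ^+ 2))%:E =
   ((pi / (1 + t)) ^+ 2 * expR (- (eucl4 x ^+ 2 * (t / (1 + t)))))%:E)%E.
Proof.
move=> t1; pose h (a y : R) := expR (- (t * (a - y) ^+ 2)) * expR (- y ^+ 2).
have mh a : measurable_fun setT (h a : measurableTypeR R -> R).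
  apply: continuous_measurable_fun => y.
  apply: cvgM; (apply: continuous_comp; last exact: continuous_expR).
    apply: cvgN; apply: cvgM; first exact: cvg_cst.
    apply: (@continuous_comp _ _ _ (fun y => a - y) (fun z => z ^+ 2)).
      by apply: cvgB; [exact: cvg_cst|exact: cvg_id].
    exact: exprn_continuous.
  by apply: cvgN; exact: exprn_continuous.
have h0 a y : 0 <= h a y by rewrite mulr_ge0 ?expR_ge0.
have Ih a := integral_gauss_shift a t1.
under eq_integral.
  move=> y _; have -> : expR (- (t * eucl4 (x - y) ^+ 2)) * expR (- eucl4 y ^+ 2)
     = h x.1.1.1 y.1.1.1 * h x.1.1.2 y.1.1.2 * h x.1.2 y.1.2 * h x.2 y.2.
    by rewrite /h !eucl4_sqr -!expRD /=; congr expR; ring.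
  over.
(* Adds one coordinate to the left-nested product. Measurability and nonnegativity are returned with
   the value, since the next application needs them. *)
have step (d : measure_display) (T : measurableType d)
    (m : {sigma_finite_measure set T -> \bar R}) (f : T -> R) (I a : R) :
    measurable_fun setT f -> (forall z, 0 <= f z) ->
    (\int[m]_z (f z)%:E = I%:E)%E ->
    [/\ measurable_fun setT (fun z : T * measurableTypeR R => f z.1 * h a z.2),
      forall z : T * measurableTypeR R, 0 <= f z.1 * h a z.2 &
      (\int[sfprod m (leb R)]_z (f z.1 * h a z.2)%:E =
        (I * (Num.sqrt (pi / (1 + t)) * expR (- (a ^+ 2 * (t / (1 + t))))))%:E)%E].
  move=> mf f0 If; split; last exact: (integral_prodM mf (mh a) f0 (h0 a) If (Ih a)).
    by apply: measurable_funM; exact: measurableT_comp.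
  by move=> z; rewrite mulr_ge0.
have [m2 h2 I2] := step _ _ (leb R) _ _ x.1.1.2 (mh x.1.1.1) (h0 _) (Ih _).
have [m3 h3 I3] := step _ _ (sfprod (leb R) (leb R)) _ _ x.1.2 m2 h2 I2.
have [_ _ I4] := step _ _ (sfprod (sfprod (leb R) (leb R)) (leb R)) _ _ x.2 m3 h3 I3.
rewrite I4; congr EFin.
have p0 : 0 <= pi / (1 + t) :> R by rewrite divr_ge0 ?pi_ge0//; lra.
have -> : (pi / (1 + t)) ^+ 2 = Num.sqrt (pi / (1 + t)) ^+ 4 :> R.
  by rewrite (exprM _ 2 2) sqr_sqrtr.
set u := t / (1 + t).
have -> : expR (- (eucl4 x ^+ 2 * u)) = expR (- (x.1.1.1 ^+ 2 * u))
    * expR (- (x.1.1.2 ^+ 2 * u)) * expR (- (x.1.2 ^+ 2 * u)) * expR (- (x.2 ^+ 2 * u)).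
  by rewrite -!expRD eucl4_sqr; congr expR; ring.
ring.
Qed.

(** * Measurability, and negligibility of a point *)

Lemma measurable_eucl4_sqr {R : realType} (x : R4 R) :
  measurable_fun setT (fun y : R4 R => eucl4 (x - y) ^+ 2).
Proof.
have mproj (p : R4 R -> measurableTypeR R) : measurable_fun setT p ->
    forall a : R, measurable_fun setT (fun y => (a - p y) ^+ 2).
  by move=> mp a; apply: measurable_funX; apply: measurable_funB.
rewrite (_ : (fun y => _) = fun y : R4 R => (x.1.1.1 - y.1.1.1) ^+ 2
   + (x.1.1.2 - y.1.1.2) ^+ 2 + (x.1.2 - y.1.2) ^+ 2 + (x.2 - y.2) ^+ 2); last first.
  by apply/funext => y; rewrite eucl4_sqr.
have m1 : measurable_fun setT (fun y : R4 R => y.1) by exact: measurable_fst.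
have m11 : measurable_fun setT (fun y : R4 R => y.1.1).
  exact: measurableT_comp measurable_fst m1.
apply: measurable_funD; [apply: measurable_funD; [apply: measurable_funD|]|];
  apply: mproj.
- exact: measurableT_comp measurable_fst m11.
- exact: measurableT_comp measurable_snd m11.
- exact: measurableT_comp measurable_snd m1.
- exact: measurable_snd.
Qed.

Lemma measurable_gauss4 {R : realType} :
  measurable_fun setT (fun y : R4 R => expR (- eucl4 y ^+ 2)).
Proof.
apply: measurableT_comp => //; apply: measurableT_comp => //.
rewrite (_ : (fun y => _) = fun y : R4 R => eucl4 (0 - y) ^+ 2).
  exact: measurable_eucl4_sqr.
by apply/funext => y; rewrite !eucl4_sqr /= !sub0r !sqrrN.
Qed.

Lemma eucl4_gt0 {R : realType} (x : R4 R) : x <> 0 -> 0 < eucl4 x.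
Proof.
move=> x0; rewrite lt_neqAle sqrtr_ge0 andbT eq_sym; apply/eqP => e0.
have := eucl4_sqr x; rewrite e0 expr0n => /esym/eqP.
rewrite !paddr_eq0 ?addr_ge0 ?sqr_ge0// !sqrf_eq0.
case: x x0 {e0} => [[[a b] c] d] /= x0 /andP[/andP[/andP[/eqP a0 /eqP b0] /eqP c0] /eqP d0].
by apply: x0; rewrite a0 b0 c0 d0.
Qed.

Lemma lebesgue4_set1 {R : realType} (x : R4 R) :
  measurable [set x] /\ ((leb4 R) [set x] = 0)%E.
Proof.
case: x => y d.
have -> : [set (y, d)] = [set y] `*` [set d].
  by apply/seteqP; split => [[u v]/= [-> ->]|[u v]/= [-> ->]].
have my : measurable [set y].
  case: y => [[a b] c].
  have -> : [set (a, b, c)] = ([set a] `*` [set b]) `*` [set c].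
    by apply/seteqP; split => [[[u v] w]/= [-> -> ->]|[[u v] w]/= [[-> ->] ->]].
  by do 2 apply: measurableX => //.
split; first exact: measurableX.
by rewrite [LHS]product_measure1E// [X in (_ * X)%E]lebesgue_measure_set1 mule0.
Qed.

(** * Tonelli's theorem for the [E1] kernel *)

(** The point [x] is removed because the integral formula for [E1 (e * s)] is available only for
    [s > 0]. *)
Lemma integral_E1_gauss4 {R : realType} (e : R) (x : R4 R) : 0 < e -> x <> 0 ->
  (leb4 R).-integrable (~` [set x])
    (fun y => (E1 (e * eucl4 (x - y) ^+ 2) * expR (- eucl4 y ^+ 2))%:E) /\
  (\int[leb4 R]_(y in ~` [set x])
     (E1 (e * eucl4 (x - y) ^+ 2) * expR (- eucl4 y ^+ 2))%:E =
   (pi ^+ 2 * (E1 (eucl4 x ^+ 2 * (e / (1 + e))) - E1 (eucl4 x ^+ 2)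
    + (expR (- eucl4 x ^+ 2) - expR (- (eucl4 x ^+ 2 * (e / (1 + e)))))
      / eucl4 x ^+ 2))%:E)%E.
Proof.
move=> e0 x0; pose g (y : R4 R) := expR (- eucl4 y ^+ 2).
pose s (y : R4 R) := eucl4 (x - y) ^+ 2.
have [mx mux] := lebesgue4_set1 x.
have r0 : 0 < eucl4 x ^+ 2 by rewrite exprn_gt0// eucl4_gt0.
(* Extending [t^-1] by zero turns the half-line into the whole line, so that Tonelli applies on a
   full product space. *)
pose k : measurableTypeR R -> R := (fun t => t^-1) \_ `[e, +oo[.
have minv : measurable_fun (`[e, +oo[ : set (measurableTypeR R)) (fun t : R => t^-1).
  apply: continuous_measurable_itvcy => t et.
  by apply: cvgV; [rewrite gt_eqF// (lt_le_trans e0)|exact: cvg_id].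
have mk : measurable_fun setT k.
  by apply: (iffLR (measurable_restrictT _ _)) minv.
have k0 t : 0 <= k t.
  rewrite /k patchE; case: ifPn => // /set_mem /=; rewrite in_itv/= andbT => et.
  by rewrite invr_ge0 (le_trans (ltW e0)).
pose f (z : R4 R * measurableTypeR R) : \bar R :=
  (k z.2 * (expR (- (z.2 * s z.1)) * g z.1))%:E.
have mf : measurable_fun setT f.
  apply/measurable_EFinP; apply: measurable_funM.
    exact: measurableT_comp mk measurable_snd.
  apply: measurable_funM.
    apply: measurableT_comp => //; apply: measurableT_comp => //.
    apply: measurable_funM; first exact: measurable_snd.
    exact: measurableT_comp (measurable_eucl4_sqr x) measurable_fst.
  exact: measurableT_comp measurable_gauss4 measurable_fst.
have f0 z : (0 <= f z)%E by rewrite lee_fin !mulr_ge0 ?expR_ge0.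
pose phi y : \bar R := (\int[leb R]_t f (y, t))%E.
have mphi : measurable_fun setT phi.
  exact: (@measurable_fun_fubini_tonelli_F _ _ _ _ _ (leb R)).
have phiE y : (~` [set x]) y -> phi y = (E1 (e * s y) * g y)%:E.
  move=> /= yx; have s0 : 0 < s y.
    by rewrite exprn_gt0// eucl4_gt0// => /subr0_eq/esym.
  rewrite EFinM -integral_E1_scale// -ge0_integralZr//; last 3 first.
  - apply/measurable_EFinP; apply: continuous_measurable_itvcy => t et.
    by apply: expint_scale_continuous; exact: lt_le_trans et.
  - move=> t; rewrite /= in_itv/= andbT => et.
    by rewrite lee_fin divr_ge0 ?expR_ge0// (le_trans (ltW e0)).
  - by rewrite lee_fin expR_ge0.
  rewrite [RHS]integral_mkcond; apply: eq_integral => t _.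
  rewrite /f /k /= !patchE; case: ifPn => _; last by rewrite mul0r.
  by rewrite -EFinM; congr EFin; ring.
have I : (\int[leb4 R]_y phi y =
   (pi ^+ 2 * (E1 (eucl4 x ^+ 2 * (e / (1 + e))) - E1 (eucl4 x ^+ 2)
    + (expR (- eucl4 x ^+ 2) - expR (- (eucl4 x ^+ 2 * (e / (1 + e)))))
      / eucl4 x ^+ 2))%:E)%E.
  rewrite EFinM -integral_gauss_kernel// -ge0_integralZl//; last 3 first.
  - apply/measurable_EFinP; apply: continuous_measurable_itvcy => t et.
    by apply: gauss_kernel_continuous; exact: lt_le_trans et.
  - move=> t; rewrite /= in_itv/= andbT => et.
    by rewrite lee_fin divr_ge0 ?expR_ge0// mulr_ge0 ?sqr_ge0 ?(le_trans (ltW e0)).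
  - by rewrite lee_fin sqr_ge0.
  (* After the exchange, the inner integral is Gaussian for [t >= e] and zero otherwise. *)
  rewrite /phi (@fubini_tonelli _ _ _ _ _ (leb4 R) (leb R))//.
  rewrite [RHS]integral_mkcond; apply: eq_integral => t _.
  rewrite /f /= patchE; case: ifPn => [/set_mem /=|tNe].
    rewrite in_itv/= andbT => et; have t0 : 0 < t by exact: lt_le_trans et.
    under eq_integral do rewrite EFinM.
    rewrite ge0_integralZl_EFin//; last 2 first.
    - by move=> y _; rewrite lee_fin mulr_ge0 ?expR_ge0.
    - apply/measurable_EFinP; apply: measurable_funM; last exact: measurable_gauss4.
      apply: measurableT_comp => //; apply: measurableT_comp => //.
      by apply: measurable_funM => //; exact: measurable_eucl4_sqr.
    rewrite integral_gauss4; last by lra.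
    rewrite /k patchE mem_set/= ?in_itv/= ?et// -!EFinM; congr EFin.
    by field; rewrite !gt_eqF// addr_gt0.
  rewrite integral0_eq// => y _.
  by rewrite /k patchE (negbTE tNe) mul0r.
have phi0 y : (0 <= phi y)%E by apply: integral_ge0.
have ID : (\int[leb4 R]_(y in ~` [set x]) phi y = \int[leb4 R]_y phi y)%E.
  by rewrite [RHS](ge0_negligible_integral mx measurableT mphi (fun y _ => phi0 y) mux) setTD.
split.
  apply: (@eq_integrable _ _ _ _ _ _ phi).
  - exact: measurableC.
  - by move=> y; rewrite inE => /phiE.
  - apply/integrableP; split; first exact: measurable_funS mphi.
    under eq_integral do rewrite gee0_abs//.
    by rewrite ID I ltry.
rewrite -I -ID; apply: eq_integral => y; rewrite inE => /phiE ->//.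
Qed.

(** * Error estimates and the limit as [e] tends to 0 *)

(** Expanding [ln (r * u)] splits the error into three terms: the Lipschitz difference, at most
    [e + r * e], then [ln (1 + e)] and [(expR (- (r * u)) - 1) / r], each at most [e] in absolute
    value. *)
Lemma E1_kernel_approx {R : realType} (e r : R) : 0 < e -> 0 < r ->
  `|E1 e - (E1 (r * (e / (1 + e))) - E1 r
      + (expR (- r) - expR (- (r * (e / (1 + e))))) / r)
    - (ln r + E1 r + (1 - expR (- r)) / r)| <= e * (r + 3).
Proof.
move=> e0 r0; have e1 : 0 < 1 + e by rewrite addr_gt0.
set u := e / (1 + e); have u0 : 0 < u by rewrite divr_gt0.
have ue : u <= e by rewrite ler_pdivrMr// ler_peMr ?ltW// ltrDl.
have h1 := E1_ln_lipschitz e0 (mulr_gt0 r0 u0).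
have h2 : `|e - r * u| <= e + r * e.
  rewrite (le_trans (ler_normB _ _))// (gtr0_norm e0) (gtr0_norm (mulr_gt0 r0 u0)) lerD2l.
  by rewrite ler_pM2l.
have lnu : ln (r * u) = ln r + (ln e - ln (1 + e)).
  by rewrite lnM ?posrE// ln_div ?posrE.
have h3 : `|ln (1 + e)| <= e.
  rewrite ger0_norm; last by rewrite ln_ge0// lerDl ltW.
  by apply: le_ln1Dx; lra.
have h4 : `|(expR (- (r * u)) - 1) / r| <= e.
  rewrite normrM (gtr0_norm (x := r^-1)) ?invr_gt0// ler_pdivrMr//.
  rewrite distrC ger0_norm; last first.
    by rewrite subr_ge0 expR_le1 oppr_le0 ltW// mulr_gt0.
  have := expR_ge1Dx (- (r * u)).
  have : r * u <= e * r by rewrite mulrC ler_pM2r.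
  lra.
have -> : E1 e - (E1 (r * u) - E1 r + (expR (- r) - expR (- (r * u))) / r)
    - (ln r + E1 r + (1 - expR (- r)) / r) =
  ((E1 e + ln e) - (E1 (r * u) + ln (r * u)) - ln (1 + e))
    + (expR (- (r * u)) - 1) / r by rewrite lnu; ring.
rewrite (le_trans (ler_normD _ _))//.
have := ler_normB ((E1 e + ln e) - (E1 (r * u) + ln (r * u))) (ln (1 + e)).
lra.
Qed.

Lemma integrable_gauss4 {R : realType} (t : R) (x : R4 R) : -1 < t ->
  (leb4 R).-integrable setT
    (fun y => (expR (- (t * eucl4 (x - y) ^+ 2)) * expR (- eucl4 y ^+ 2))%:E).
Proof.
move=> t1; apply/integrableP; split.
  apply/measurable_EFinP; apply: measurable_funM; last exact: measurable_gauss4.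
  apply: measurableT_comp => //; apply: measurableT_comp => //.
  by apply: measurable_funM => //; exact: measurable_eucl4_sqr.
under eq_integral do rewrite /= ger0_norm ?mulr_ge0 ?expR_ge0//.
by rewrite integral_gauss4// ltry.
Qed.

Lemma integral_ln_gauss4 {R : realType} (x : R4 R) : x <> 0 ->
  (leb4 R).-integrable setT
    (fun y => (ln (eucl4 (x - y) ^+ 2) * expR (- eucl4 y ^+ 2))%:E) /\
  (\int[leb4 R]_y (ln (eucl4 (x - y) ^+ 2) * expR (- eucl4 y ^+ 2))%:E =
   (pi ^+ 2 * (ln (eucl4 x ^+ 2) + E1 (eucl4 x ^+ 2)
     + (1 - expR (- eucl4 x ^+ 2)) / eucl4 x ^+ 2))%:E)%E.
Proof.
(* With [u = s y], this bounds [s * g] by twice the integrable function of the case [t = -1/2]. *)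
have le_2expR (u : R) : u <= 2 * expR (- (- 2^-1 * u)).
  by have := expR_ge1Dx (- (- 2^-1 * u)); lra.
move=> x0; pose g (y : R4 R) := expR (- eucl4 y ^+ 2).
pose s (y : R4 R) := eucl4 (x - y) ^+ 2; set r := eucl4 x ^+ 2.
have r0 : 0 < r by rewrite exprn_gt0// eucl4_gt0.
have [mx mux] := lebesgue4_set1 x.
pose D := ~` [set x]; have mD : measurable D by exact: measurableC.
have g0 y : 0 <= g y by exact: expR_ge0.
have sD y : D y -> 0 < s y.
  by move=> yx; rewrite exprn_gt0// eucl4_gt0// => /subr0_eq/esym.
have ms : measurable_fun setT s by exact: measurable_eucl4_sqr.
have mg : measurable_fun setT g by exact: measurable_gauss4.
have ig : (leb4 R).-integrable setT (EFin \o g).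
  apply: eq_integrable (integrable_gauss4 x (ltrN10 R)) => //.
  by move=> y _; rewrite mul0r oppr0 expR0 mul1r.
have Ig : (\int[leb4 R]_y (g y)%:E = (pi ^+ 2)%:E)%E.
  under eq_integral.
    move=> y _; have -> : g y = expR (- (0 * eucl4 (x - y) ^+ 2)) * g y.
      by rewrite mul0r oppr0 expR0 mul1r.
    over.
  by rewrite integral_gauss4 ?ltrN10// mul0r mulr0 oppr0 expR0 mulr1 addr0 divr1.
have igD : (leb4 R).-integrable D (EFin \o g) by exact: integrableS ig.
have IgD : \int[leb4 R]_(y in D) g y = pi ^+ 2.
  by rewrite /Rintegral -[D]setTD -(negligible_integral mx measurableT ig mux) Ig.
(* On [D], [A e] approximates the integrand [L] with error at most [e * B]. *)
pose L y := ln (s y) * g y; pose B y := (1 + s y) * g y.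
pose A e y := (E1 e - E1 (e * s y)) * g y.
have mL : measurable_fun setT L.
  by apply: measurable_funM => //; apply: measurableT_comp => //; exact: measurable_ln.
have B0 y : 0 <= B y by rewrite mulr_ge0// addr_ge0// sqr_ge0.
have iB : (leb4 R).-integrable D (EFin \o B).
  have t2 : -1 < - 2^-1 :> R by rewrite ltrN2 invf_lt1// ltr1n.
  have ih : (leb4 R).-integrable setT (fun y => (g y)%:E + 2%:E *
      (expR (- (- 2^-1 * eucl4 (x - y) ^+ 2)) * expR (- eucl4 y ^+ 2))%:E)%E.
    by apply: integrableD => //; apply: integrableZl => //; exact: integrable_gauss4.
  apply: le_integrable (integrableS measurableT mD (@subsetT _ _) ih) => //.
    apply/measurable_EFinP; apply: measurable_funTS.
    by apply: measurable_funM => //; exact: measurable_funD.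
  move=> y _; rewrite -EFinM -EFinD lee_fin -/(g y) -/(s y).
  rewrite (ger0_norm (B0 y)) ger0_norm; last by rewrite addr_ge0 ?mulr_ge0 ?expR_ge0.
  by rewrite /B mulrDl mul1r lerD2l [leRHS]mulrA ler_wpM2r//.
have iA e : 0 < e -> (leb4 R).-integrable D (EFin \o A e).
  move=> e0; have [i1 _] := integral_E1_gauss4 e0 x0.
  have : (leb4 R).-integrable D (fun y => (E1 e)%:E * (g y)%:E
      - (E1 (e * eucl4 (x - y) ^+ 2) * expR (- eucl4 y ^+ 2))%:E)%E.
    by apply: integrableB => //; exact: integrableZl.
  apply: eq_integrable; first exact: mD.
  by move=> z _; rewrite /= /A mulrBl.
have iZ (c : R) f : (leb4 R).-integrable D (EFin \o f) ->
    (leb4 R).-integrable D (EFin \o (fun y => c * f y)).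
  by move=> /(integrableZl mD c); apply: eq_integrable => // z _; rewrite /= EFinM.
pose K e := E1 (r * (e / (1 + e))) - E1 r
    + (expR (- r) - expR (- (r * (e / (1 + e))))) / r.
have IA e : 0 < e -> \int[leb4 R]_(y in D) A e y = pi ^+ 2 * (E1 e - K e).
  move=> e0; have [i1 I1] := integral_E1_gauss4 e0 x0.
  transitivity (\int[leb4 R]_(y in D) (E1 e * g y - E1 (e * s y) * g y)).
    by apply: eq_Rintegral => z _; rewrite /A mulrBl.
  rewrite RintegralB//; last exact: iZ.
  rewrite RintegralZl// IgD [X in _ - X](_ : _ = pi ^+ 2 * K e); first by ring.
  by rewrite /Rintegral I1.
have LA e (z : R4 R) : 0 < e -> D z -> `|L z - A e z| <= e * B z.
  move=> e0 /sD sy0; rewrite /L /A /B -mulrBl normrM (ger0_norm (g0 z)) [leRHS]mulrA.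
  by rewrite ler_wpM2r//; exact: ln_E1_approx.
(* The approximation at [e = 1] already suffices: [L] is dominated by the sum of [B] and the
   absolute value of [A 1]. *)
have iL : (leb4 R).-integrable D (EFin \o L).
  have iAB := integrableD mD (integrable_norm (iA _ ltr01)) iB.
  apply: le_integrable iAB => //.
    by apply/measurable_EFinP; apply: measurable_funTS.
  move=> y Dy; rewrite /= lee_fin.
  rewrite (ger0_norm (x := _ + _)); last first.
    by rewrite addr_ge0.
  rewrite -{1}(subrKC (A 1 y) (L y)) (le_trans (ler_normD _ _))// lerD2l.
  by rewrite -(mul1r (B y)) LA.
have iLA e : 0 < e -> (leb4 R).-integrable D (EFin \o (fun y => L y - A e y)).
  by move=> e0; apply: eq_integrable (integrableB mD iL (iA _ e0)).
have iLT : (leb4 R).-integrable setT (EFin \o L).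
  apply/(negligible_integrable mx measurableT _ mux); last by rewrite setTD.
  exact/measurable_EFinP.
split; first exact: iLT.
rewrite [LHS](negligible_integral mx measurableT iLT mux) setTD -/D.
pose J := ln r + E1 r + (1 - expR (- r)) / r.
pose I := \int[leb4 R]_(y in D) L y.
rewrite -[LHS]fineK; last exact: integrable_fin_num.
congr EFin; rewrite -/I -/J.
pose M := \int[leb4 R]_(y in D) B y.
(* [e * M] comes from integrating the pointwise error, the rest from the error of the closed
   form. *)
have est e : 0 < e -> `|I - pi ^+ 2 * J| <= e * (M + pi ^+ 2 * (r + 3)).
  move=> e0.
  have -> : I - pi ^+ 2 * J = (I - pi ^+ 2 * (E1 e - K e))
    + pi ^+ 2 * (E1 e - K e - J) by ring.
  rewrite (le_trans (ler_normD _ _))// [leRHS]mulrDr lerD//.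
    rewrite -IA// -RintegralB//; last exact: iA.
    rewrite (le_trans (le_normr_Rintegral _ _))//; first exact: iLA.
    rewrite -RintegralZl//; apply: le_Rintegral => //.
    - by apply: integrable_norm; exact: iLA.
    - exact: iZ.
    - by move=> y; exact: LA.
  rewrite normrM ger0_norm ?sqr_ge0// mulrCA ler_wpM2l ?sqr_ge0//.
  exact: E1_kernel_approx.
(* If the distance [d] were positive, [e = d / (|c| + 1)] in [est] would give
   [d <= d * c / (|c| + 1) < d]. *)
apply/eqP; rewrite -subr_eq0 -normr_le0 leNgt; apply/negP => d0.
set d := `|_| in est d0; set c := M + _ in est.
have c1 : 0 < `|c| + 1 by rewrite ltr_wpDl.
have := est _ (divr_gt0 d0 c1); apply/negP; rewrite -ltNge.
rewrite mulrAC ltr_pdivrMr// ltr_pM2l//.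
by rewrite (le_lt_trans (ler_norm c))// ltrDl.
Qed.

(** * The biharmonic potential of the Gaussian *)

Unset Implicit Arguments.
Set Strict Implicit.
Set Printing Implicit Defensive.

Theorem theorem3p2 (R : realType) (x : R4 R) (x_neq0 : x <> 0) :
  biharmonic4 (fun y : R4 R => expR (- eucl4 y ^+ 2)) x =
  (16^-1 * ((expR (- eucl4 x ^+ 2) - 1) / eucl4 x ^+ 2
            - 2 * ln (eucl4 x) - E1 (eucl4 x ^+ 2)))%:E.
Proof.
have [iL IL] := integral_ln_gauss4 x_neq0.
(* The case [a = 0] holds because [ln 0] is 0 by convention; it lets the integrand be rewritten at
   every [y], including [y = x]. The factor [2^-1] turns [8] into [16]. *)
have lnE (a : R) : 0 <= a -> ln a = 2^-1 * ln (a ^+ 2).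
  rewrite le0r => /predU1P[->|a0]; first by rewrite expr0n/= ln0// mulr0.
  by rewrite (lnXn 2)// -[ln a *+ 2]mulr_natl mulKf ?pnatr_eq0.
(* Both sides are the same iterated product measure by conversion. *)
rewrite /biharmonic4 (_ : @lebesgue4 R = leb4 R)//.
under eq_integral.
  move=> y _; rewrite (lnE (eucl4 (x - y))) ?sqrtr_ge0// -mulrA EFinM; over.
rewrite integralZl// IL -!EFinM; congr EFin.
have p0 : pi != 0 :> R by rewrite gt_eqF// pi_gt0.
have r0 : eucl4 x != 0 by rewrite gt_eqF// eucl4_gt0.
rewrite (lnE (eucl4 x)) ?sqrtr_ge0//.
by move: (pi : R) p0 => p p0; field; rewrite r0 p0.
Qed.
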